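(* Let $H$ be a CQG algebra, $\Gamma$ a finite group, and $\pi:H\to\mathbb{C}[\Gamma]$ a surjective normal morphism of CQG algebras. Let $P\le H$ be the Hopf kernel of $\pi$. Then $H$ is RFD if and only if $P$ is RFD.
   Context: All algebras are unital and over $\mathbb{C}$; Sweedler notation $\Delta(h)=h_1\otimes h_2$ is used. A CQG algebra is a Hopf $*$-algebra that is the linear span of the matrix coefficients of its finite-dimensional unitary comodules; a morphism of CQG algebras is a Hopf algebra morphism preserving $*$. The group algebra $\mathbb{C}[\Gamma]$ is a CQG algebra with $\Delta(\gamma)=\gamma\otimes\gamma$, $\varepsilon(\gamma)=1$, $\gamma^*=\gamma^{-1}$ for $\gamma\in\Gamma$. A map $\pi:H\to K$ of CQG algebras is normal if the sets $\{h\in H \mid \pi(h_1)\otimes h_2=1_K\otimes h\}$ and $\{h\in H\mid h_1\otimes\pi(h_2)=h\otimes 1_K\}$ are equal. In that case this common set $P$ is a Hopf $*$-subalgebra of $H$, called the Hopf kernel of $\pi$. RFD: a $*$-algebra $A$ is residually finite-dimensional (RFD) if for every $0\ne a\in A$ there is a $*$-representation $\pi$ of $A$ on a finite-dimensional Hilbert space with $\pi(a)\ne 0$. *)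

(* Defs.v *)
From HB Require Import structures.
From mathcomp Require Import all_boot all_order all_fingroup all_algebra.
From mathcomp Require Import sesquilinear ring_quotient complex.
From mathcomp Require Import boolp reals.
From mathcomp Require Import finmap monalg.

Set Implicit Arguments.
Unset Strict Implicit.
Unset Printing Implicit Defensive.

Import Order.TTheory GRing.Theory Num.Theory.
Local Open Scope ring_scope.
Local Open Scope quotient_scope.

(** [tens U V] is the free vector space on the set [U * V], modulo the subspace
    generated by the bilinearity relations. *)

Section TensorProduct.
Variables (C : numClosedFieldType) (U V : lmodType C).
Local Notation free := {malg C[(U * V)%type]}.
Local Notation gen u v := (mkmalgU (u, v) 1 : free).

Inductive tens_null : free -> Prop :=
| tens_null0 : tens_null 0
| tens_nullP a x y : tens_null x -> tens_null y -> tens_null (a *: x + y)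
| tens_nullDl u u' v : tens_null (gen (u + u') v - (gen u v + gen u' v))
| tens_nullDr u v v' : tens_null (gen u (v + v') - (gen u v + gen u v'))
| tens_nullZl a u v : tens_null (gen (a *: u) v - a *: gen u v)
| tens_nullZr a u v : tens_null (gen u (a *: v) - a *: gen u v).

Definition tens_rel : {pred free} := fun x => `[< tens_null x >].

Lemma tens_rel_submod_closed : submod_closed tens_rel.
Proof.
split=> [|a x y /asboolP Nx /asboolP Ny]; apply/asboolP; first exact: tens_null0.
exact: tens_nullP.
Qed.
HB.instance Definition _ :=
  GRing.isSubmodClosed.Build C free tens_rel tens_rel_submod_closed.

Definition tens : Type := Quotient.quot tens_rel.
HB.instance Definition _ := GRing.Zmodule.on tens.

Definition tens_pi : free -> tens := \pi_(Quotient.quot tens_rel).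
Definition tens_repr : tens -> free := generic_quotient.repr.

Lemma tens_reprK : cancel tens_repr tens_pi.
Proof. by move=> t; rewrite /tens_pi /tens_repr reprK. Qed.

Lemma tens_piP x y : tens_pi x = tens_pi y <-> tens_null (x - y).
Proof.
split=> [/eqP|xy].
  by rewrite -Quotient.idealrBE => /asboolP.
by apply/eqP; rewrite -Quotient.idealrBE; apply/asboolP.
Qed.

Lemma tens_piD : {morph tens_pi : x y / x + y}.
Proof. exact: Quotient.pi_add. Qed.

Definition tens_scale a (t : tens) : tens := tens_pi (a *: tens_repr t).

Lemma tens_piZ a x : tens_pi (a *: x) = tens_scale a (tens_pi x).
Proof.
apply/tens_piP; rewrite -scalerBr -[_ *: _]addr0; apply: tens_nullP.
  by apply/tens_piP; rewrite tens_reprK.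
exact: tens_null0.
Qed.

Lemma tens_scaleA a b t : tens_scale a (tens_scale b t) = tens_scale (a * b) t.
Proof. by rewrite -[t]tens_reprK -!tens_piZ scalerA. Qed.
Lemma tens_scale1 : left_id 1 tens_scale.
Proof. by move=> t; rewrite -[t]tens_reprK -!tens_piZ scale1r. Qed.
Lemma tens_scaleDr : right_distributive tens_scale +%R.
Proof.
move=> a s t; rewrite -[t]tens_reprK -[s]tens_reprK.
by rewrite -tens_piD -!tens_piZ -tens_piD scalerDr.
Qed.
Lemma tens_scaleDl t : {morph tens_scale^~ t : a b / a + b}.
Proof.
by move=> a b; rewrite -[t]tens_reprK -!tens_piZ -tens_piD scalerDl.
Qed.
HB.instance Definition _ := GRing.Zmodule_isLmodule.Build C tens
  tens_scaleA tens_scale1 tens_scaleDr tens_scaleDl.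

Lemma tens_pi_is_linear : linear tens_pi.
Proof. by move=> a x y; rewrite tens_piD tens_piZ. Qed.
HB.instance Definition _ := GRing.isLinear.Build C free tens *:%R tens_pi
  tens_pi_is_linear.

Definition pure (u : U) (v : V) : tens := tens_pi (gen u v).

Lemma pureDl v : {morph pure^~ v : u u' / u + u'}.
Proof.
move=> u u'; rewrite /pure -tens_piD; apply/tens_piP; exact: tens_nullDl.
Qed.
Lemma pureDr u : {morph pure u : v v' / v + v'}.
Proof.
move=> v v'; rewrite /pure -tens_piD; apply/tens_piP; exact: tens_nullDr.
Qed.
Lemma pureZl a u v : pure (a *: u) v = a *: pure u v.
Proof. by rewrite /pure -linearZ; apply/tens_piP; exact: tens_nullZl. Qed.
Lemma pureZr a u v : pure u (a *: v) = a *: pure u v.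
Proof. by rewrite /pure -linearZ; apply/tens_piP; exact: tens_nullZr. Qed.

Lemma tens_sum (t : tens) : exists s : seq (U * V), t = \sum_(p <- s) pure p.1 p.2.
Proof.
exists [seq ((tens_repr t)@_k *: k.1, k.2) | k <- msupp (tens_repr t)].
rewrite big_map -[LHS]tens_reprK {1}[tens_repr t]monalgE raddf_sum /=.
apply: eq_bigr => -[u v] _ /=; rewrite pureZl -[RHS]linearZ /=; congr tens_pi.
by apply/malgP => k; rewrite mcoeffZ !mcoeffU mulrnAr mulr1.
Qed.

Lemma tens_ind (P : tens -> Prop) :
  (forall u v, P (pure u v)) -> (forall s t, P s -> P t -> P (s + t)) ->
  forall t, P t.
Proof.
move=> Ppure PD t; have [s ->] := tens_sum t.
elim: s => [|p s IHs]; last by rewrite big_cons; apply: PD.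
by rewrite big_nil -(scale0r (pure 0 0)) -pureZl.
Qed.

End TensorProduct.

Notation "u ⊗ v" := (pure u v) (at level 40, left associativity) : ring_scope.

(** The universal property.  [tlift_for sigma f] is the map sending [u ⊗ v] to
    [f u v]; it is meaningful when [f] is additive and [sigma]-semilinear in
    each argument, [sigma] being the identity (for linear maps) or the complex
    conjugation (for antilinear maps). *)
HB.lock Definition tlift_for (C : numClosedFieldType) (U V W : lmodType C)
    (sigma : C -> C) (f : U -> V -> W) (t : tens U V) : W :=
  \sum_(k <- msupp (tens_repr t)) sigma (tens_repr t)@_k *: f k.1 k.2.

Notation tlift := (tlift_for idfun).

Section Lift.
Variables (C : numClosedFieldType) (U V W : lmodType C) (sigma : {rmorphism C -> C}).
Local Notation gen u v := (mkmalgU (u, v) 1 : {malg C[(U * V)%type]}).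

Definition semibilinear (f : U -> V -> W) :=
  [/\ forall v, {morph f^~ v : u u' / u + u'},
      forall u, {morph f u : v v' / v + v'},
      forall a u v, f (a *: u) v = sigma a *: f u v &
      forall a u v, f u (a *: v) = sigma a *: f u v].

Variable f : U -> V -> W.
Hypothesis f_bil : semibilinear f.

Let eval (x : {malg C[(U * V)%type]}) : W := \sum_(k <- msupp x) sigma x@_k *: f k.1 k.2.

Let evalw (d : {fset (U * V)%type}) x : (msupp x `<=` d)%fset ->
  eval x = \sum_(k <- d) sigma x@_k *: f k.1 k.2.
Proof.
move=> xd; rewrite /eval; apply: big_fset_incl => //.
by move=> k _ kx; rewrite mcoeff_outdom // rmorph0 scale0r.
Qed.

Let evalP a x y : eval (a *: x + y) = sigma a *: eval x + eval y.
Proof.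
pose d := (msupp x `|` msupp y `|` msupp (a *: x + y))%fset.
have [xd yd zd] : [/\ msupp x `<=` d, msupp y `<=` d & msupp (a *: x + y) `<=` d]%fset.
  split; apply/fsubsetP => k; rewrite !in_fsetU => -> //; by rewrite ?orbT.
rewrite (evalw xd) (evalw yd) (evalw zd) scaler_sumr -big_split /=.
apply: eq_bigr => k _.
by rewrite mcoeffD mcoeffZ rmorphD rmorphM scalerDl scalerA.
Qed.

Let evalU u v : eval (gen u v) = f u v.
Proof.
by rewrite /eval msuppU oner_eq0 big_seq_fset1 mcoeffUU rmorph1 scale1r.
Qed.

Let eval_null x : tens_null x -> eval x = 0.
Proof.
case: f_bil => fDl fDr fZl fZr.
have eval0 : eval 0 = 0 by rewrite /eval msupp0 big_seq_fset0.
have evalD y z : eval (y + z) = eval y + eval z.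
  by rewrite -[y]scale1r evalP rmorph1 !scale1r.
have evalZ a y : eval (a *: y) = sigma a *: eval y.
  by rewrite -[a *: y]addr0 evalP eval0 addr0.
have evalN y : eval (- y) = - eval y.
  by rewrite -[in LHS]scaleN1r evalZ rmorphN1 scaleN1r.
elim=> [|a y z _ y0 _ z0|u u' v|u v v'|a u v|a u v] //.
- by rewrite evalP y0 z0 scaler0 addr0.
- by rewrite evalD evalN evalD !evalU fDl subrr.
- by rewrite evalD evalN evalD !evalU fDr subrr.
- by rewrite evalD evalN evalZ !evalU fZl subrr.
- by rewrite evalD evalN evalZ !evalU fZr subrr.
Qed.

Let tlift_pi x : tlift_for sigma f (tens_pi x) = eval x.
Proof.
have /eval_null : tens_null (-1 *: tens_repr (tens_pi x) + x).
  by rewrite scaleN1r addrC; apply/tens_piP; rewrite tens_reprK.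
rewrite evalP rmorphN1 scaleN1r addrC => /eqP.
by rewrite tlift_for.unlock subr_eq0 => /eqP ->.
Qed.

Lemma tlift_forE u v : tlift_for sigma f (pure u v) = f u v.
Proof. by rewrite tlift_pi evalU. Qed.

Lemma tlift_forP a s t :
  tlift_for sigma f (a *: s + t) = sigma a *: tlift_for sigma f s + tlift_for sigma f t.
Proof.
by rewrite -[s]tens_reprK -[t]tens_reprK -linearP !tlift_pi evalP.
Qed.

Lemma tlift_forD : {morph tlift_for sigma f : s t / s + t}.
Proof. by move=> s t; rewrite -[s in LHS]scale1r tlift_forP rmorph1 scale1r. Qed.

Lemma tlift_forZ a t : tlift_for sigma f (a *: t) = sigma a *: tlift_for sigma f t.
Proof.
have tlift0 : tlift_for sigma f 0 = 0 by apply: (addIr (tlift_for sigma f 0)); rewrite -tlift_forD !add0r.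
by rewrite -[a *: t]addr0 tlift_forP tlift0 addr0.
Qed.
End Lift.

Lemma tlift_for_bil (C : numClosedFieldType) (U V W X : lmodType C)
    (sigma : {rmorphism C -> C}) (g : W -> U -> V -> X) :
    (forall w, semibilinear sigma (g w)) ->
    (forall u v, {morph (fun w => g w u v) : w w' / w + w'}) ->
    (forall a u v w, g (a *: w) u v = sigma a *: g w u v) ->
  semibilinear sigma (fun t w => tlift_for sigma (g w) t).
Proof.
move=> gbil gD gZ; split=> [w|t w w'|a t w|a t w].
- exact: tlift_forD.
- elim/tens_ind: t => [u v|s t IHs IHt]; first by rewrite !tlift_forE ?gD.
  by rewrite !tlift_forD // IHs IHt addrACA.
- exact: tlift_forZ.
- elim/tens_ind: t => [u v|s t IHs IHt]; first by rewrite !tlift_forE ?gZ.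
  by rewrite !tlift_forD // IHs IHt scalerDr.
Qed.

Section TensorOperations.
Variable C : numClosedFieldType.

Definition tmap (U V U' V' : lmodType C) (f : U -> U') (g : V -> V') :
    tens U V -> tens U' V' :=
  tlift (fun u v => f u ⊗ g v).

Definition tassoc (U V W : lmodType C) :
    tens (tens U V) W -> tens U (tens V W) :=
  tlift (fun t w => tlift (fun u v => u ⊗ (v ⊗ w)) t).

Definition tmul (A B : algType C) (s t : tens A B) : tens A B :=
  tlift (fun a b => tlift (fun a' b' => (a * a') ⊗ (b * b')) t) s.

Section Tmap.
Variables (U V U' V' : lmodType C) (f : {linear U -> U'}) (g : {linear V -> V'}).

Lemma tmap_bil : semibilinear idfun (fun u v => f u ⊗ g v).
Proof.
by split=> [v u u'|u v v'|a u v|a u v]; rewrite ?(linearD, linearZ) /= ?(pureDl, pureDr, pureZl, pureZr).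
Qed.
Lemma tmapE u v : tmap f g (u ⊗ v) = f u ⊗ g v.
Proof. exact: (tlift_forE tmap_bil). Qed.
Lemma tmap_is_linear : linear (tmap f g).
Proof. by move=> a s t; rewrite /tmap (tlift_forP tmap_bil). Qed.
HB.instance Definition _ := GRing.isLinear.Build C (tens U V) (tens U' V') *:%R
  (tmap f g) tmap_is_linear.
End Tmap.

Section Tassoc.
Variables U V W : lmodType C.

Let inner_bil (w : W) :
  semibilinear idfun (fun (u : U) (v : V) => u ⊗ (v ⊗ w)).
Proof. by split=> [v u u'|u v v'|a u v|a u v]; rewrite ?(pureDl, pureDr, pureZl, pureZr). Qed.

Let outer_bil : semibilinear idfun
  (fun (t : tens U V) (w : W) => tlift (fun u v => u ⊗ (v ⊗ w)) t).
Proof.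
apply: tlift_for_bil => // [u v w w'|a u v w];
  by rewrite ?(pureDl, pureDr, pureZl, pureZr).
Qed.

Lemma tassocE u v w : tassoc (u ⊗ v ⊗ w) = u ⊗ (v ⊗ w) :> tens U (tens V W).
Proof.
by rewrite /tassoc (tlift_forE outer_bil) (tlift_forE (inner_bil w)).
Qed.
Lemma tassoc_is_linear : linear (@tassoc U V W).
Proof. by move=> a s t; rewrite /tassoc (tlift_forP outer_bil). Qed.
HB.instance Definition _ := GRing.isLinear.Build C (tens (tens U V) W) _ *:%R
  (@tassoc U V W) tassoc_is_linear.
End Tassoc.

Section Tmul.
Variables A B : algType C.

Let inner_bil (a : A) (b : B) :
  semibilinear idfun (fun a' b' => (a * a') ⊗ (b * b')).
Proof.
split=> [v u u'|u v v'|c u v|c u v] /=; rewrite ?(mulrDr, mulrDl) -?(scalerAr, scalerAl);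
  by rewrite ?(pureDl, pureDr, pureZl, pureZr).
Qed.

Let mulp a b (t : tens A B) := tlift (fun a' b' => (a * a') ⊗ (b * b')) t.
Let mulpE a b a' b' : mulp a b (a' ⊗ b') = (a * a') ⊗ (b * b').
Proof. exact: tlift_forE (inner_bil a b) a' b'. Qed.
Let mulpD a b : {morph mulp a b : s t / s + t}.
Proof. exact: tlift_forD (inner_bil a b). Qed.
Let mulpZ a b c t : mulp a b (c *: t) = c *: mulp a b t.
Proof. exact: tlift_forZ (inner_bil a b) c t. Qed.

Let outer_bil (t : tens A B) : semibilinear idfun
  (fun a b => mulp a b t).
Proof.
split=> [b a a'|a b b'|c a b|c a b];
  elim/tens_ind: t => [a0 b0|s t IHs IHt].
- by rewrite !mulpE mulrDl pureDl.
- by rewrite !mulpD IHs IHt addrACA.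
- by rewrite !mulpE mulrDl pureDr.
- by rewrite !mulpD IHs IHt addrACA.
- by rewrite !mulpE -scalerAl pureZl.
- by rewrite !mulpD IHs IHt scalerDr.
- by rewrite !mulpE -scalerAl pureZr.
- by rewrite !mulpD IHs IHt scalerDr.
Qed.

Let tmulp (a : A) (b : B) (t : tens A B) : tmul (a ⊗ b) t = mulp a b t.
Proof. exact: tlift_forE (outer_bil t) a b. Qed.

Lemma tmulE (a a' : A) (b b' : B) : tmul (a ⊗ b) (a' ⊗ b') = (a * a') ⊗ (b * b').
Proof. by rewrite tmulp mulpE. Qed.

Lemma tmulDl (t : tens A B) : {morph (fun s : tens A B => tmul s t) : s s' / s + s'}.
Proof. exact: tlift_forD (outer_bil t). Qed.

Lemma tmulDr (s : tens A B) : {morph (fun t : tens A B => tmul s t) : t t' / t + t'}.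
Proof.
move=> t t'; elim/tens_ind: s => [a b|s s' IHs IHs'].
  by rewrite !tmulp mulpD.
by rewrite !tmulDl IHs IHs' addrACA.
Qed.

Lemma tmulZl a (s t : tens A B) : tmul (a *: s) t = a *: tmul s t.
Proof. exact: tlift_forZ (outer_bil t) a s. Qed.

Lemma tmulZr a (s t : tens A B) : tmul s (a *: t) = a *: tmul s t.
Proof.
elim/tens_ind: s => [x y|s s' IHs IHs']; last by rewrite !tmulDl IHs IHs' scalerDr.
by rewrite !tmulp mulpZ.
Qed.
End Tmul.
End TensorOperations.

HB.mixin Record isStarAlgebra (C : numClosedFieldType) A
    of GRing.Algebra C A := {
  star : A -> A;
  starD : {morph star : x y / x + y};
  starZ : forall c x, star (c *: x) = c^* *: star x;
  starM : forall x y, star (x * y) = star y * star x;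
  starK : involutive star
}.
#[short(type="starAlgType")]
HB.structure Definition StarAlgebra (C : numClosedFieldType) :=
  {A of GRing.Algebra C A & isStarAlgebra C A}.

Lemma star1 (C : numClosedFieldType) (A : starAlgType C) : star (1 : A) = 1.
Proof.
by rewrite -[LHS]mulr1 -[X in _ * X](starK (1 : A)) -starM mulr1 starK.
Qed.

Section TensorStar.
Variables (C : numClosedFieldType) (A B : starAlgType C).

Definition tstar : tens A B -> tens A B :=
  tlift_for Num.conj (fun a b => star a ⊗ star b).

Let tstar_bil :
  semibilinear Num.conj (fun (a : A) (b : B) => star a ⊗ star b).
Proof.
by split=> [v u u'|u v v'|a u v|a u v]; rewrite ?(starD, starZ) ?(pureDl, pureDr, pureZl, pureZr).
Qed.

Lemma tstarE a b : tstar (a ⊗ b) = star a ⊗ star b.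
Proof. exact: (tlift_forE tstar_bil). Qed.
Lemma tstarD : {morph tstar : s t / s + t}.
Proof. exact: (tlift_forD tstar_bil). Qed.
Lemma tstarZ c t : tstar (c *: t) = c^* *: tstar t.
Proof. exact: (tlift_forZ tstar_bil). Qed.
End TensorStar.

HB.mixin Record isHopfStarAlgebra (C : numClosedFieldType) H
    of StarAlgebra C H := {
  comult : {linear H -> tens H H};
  counit : {scalar H};
  antipode : {linear H -> H};
  coassoc : forall h,
    tassoc (tmap comult idfun (comult h)) = tmap idfun comult (comult h);
  counitl : forall h, tlift (fun h1 h2 => counit h1 *: h2) (comult h) = h;
  counitr : forall h, tlift (fun h1 h2 => counit h2 *: h1) (comult h) = h;
  comult1 : comult 1 = 1 ⊗ 1;
  comultM : forall h k, comult (h * k) = tmul (comult h) (comult k);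
  counit1 : counit 1 = 1;
  counitM : forall h k, counit (h * k) = counit h * counit k;
  antipodel : forall h,
    tlift (fun h1 h2 => antipode h1 * h2) (comult h) = counit h *: 1;
  antipoder : forall h,
    tlift (fun h1 h2 => h1 * antipode h2) (comult h) = counit h *: 1;
  comult_star : forall h, comult (star h) = tstar (comult h);
  counit_star : forall h, counit (star h) = (counit h)^*
}.
#[short(type="hopfStarAlgType")]
HB.structure Definition HopfStarAlgebra (C : numClosedFieldType) :=
  {H of StarAlgebra C H & isHopfStarAlgebra C H}.

(** A finite-dimensional Hilbert space is a [vectType C] with a positive
    definite form [dot], linear in its first argument and antilinear in the
    second one. *)
Section UnitaryComodule.
Variables (C : numClosedFieldType) (H : hopfStarAlgType C).
Variables (V : vectType C) (dot : {dot V for Num.conj}).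

Definition is_comodule (rho : {linear V -> tens V H}) :=
  (forall v, tassoc (tmap rho idfun (rho v)) = tmap idfun comult (rho v)) /\
  (forall v, tlift (fun v0 v1 => counit v1 *: v0) (rho v) = v).

(** The coaction is isometric for the [H]-valued inner product on [V ⊗ H]:
    <v_0, w_0> (w_1)^* v_1 = <v, w> 1.  For rho(e_j) = \sum_i e_i ⊗ u_ij in an
    orthonormal basis, this says that u^* u = 1 (u u^* = 1 then follows from the
    antipode). *)
Definition is_unitary_comodule (rho : {linear V -> tens V H}) :=
  forall v w,
    tlift (fun v0 v1 =>
      tlift_for Num.conj (fun w0 w1 => dot v0 w0 *: (star w1 * v1)) (rho w))
      (rho v) = dot v w *: 1.

Definition matrix_coef (rho : {linear V -> tens V H}) (v w : V) : H :=
  tlift (fun v0 v1 => dot v0 w *: v1) (rho v).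
End UnitaryComodule.

Definition unitary_coef (C : numClosedFieldType) (H : hopfStarAlgType C) (h : H) :=
  exists (V : vectType C) (dot : {dot V for Num.conj})
         (rho : {linear V -> tens V H}),
    [/\ is_comodule rho, is_unitary_comodule dot rho &
        exists v w, h = matrix_coef dot rho v w].

HB.mixin Record isCQG (C : numClosedFieldType) H of HopfStarAlgebra C H := {
  cqg_span : forall h : H, exists s : seq (C * H),
    (forall p, p \in s -> unitary_coef p.2) /\ h = \sum_(p <- s) p.1 *: p.2
}.
#[short(type="cqgAlgType")]
HB.structure Definition CQGAlgebra (C : numClosedFieldType) :=
  {H of HopfStarAlgebra C H & isCQG C H}.

Record cqgMorphism (C : numClosedFieldType) (H K : cqgAlgType C) := CQGMorphism {
  cqg_fun :> {lrmorphism H -> K};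
  cqg_comult : forall h, comult (cqg_fun h) = tmap cqg_fun cqg_fun (comult h);
  cqg_counit : forall h, counit (cqg_fun h) = counit h;
  cqg_antipode : forall h, cqg_fun (antipode h) = antipode (cqg_fun h);
  cqg_star : forall h, cqg_fun (star h) = star (cqg_fun h)
}.

Section HopfKernel.
Variables (C : numClosedFieldType) (H K : cqgAlgType C) (pi : cqgMorphism H K).

Definition lcoinvariant : {pred H} :=
  fun h => `[< tmap pi idfun (comult h) = 1 ⊗ h >].
Definition rcoinvariant : {pred H} :=
  fun h => `[< tmap idfun pi (comult h) = h ⊗ 1 >].
Definition normal_morphism := lcoinvariant =i rcoinvariant.

Lemma lcoinvariantP h :
  reflect (tmap pi idfun (comult h) = 1 ⊗ h) (h \in lcoinvariant).
Proof. exact: asboolP. Qed.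

Lemma rcoinvariantP h :
  reflect (tmap idfun pi (comult h) = h ⊗ 1) (h \in rcoinvariant).
Proof. exact: asboolP. Qed.

Let tmapM (s t : tens H H) :
  tmap pi idfun (tmul s t) = tmul (tmap pi idfun s) (tmap pi idfun t).
Proof.
elim/tens_ind: s => [a b|s s' IHs IHs']; last first.
  by rewrite tmulDl !linearD /= tmulDl IHs IHs'.
elim/tens_ind: t => [a' b'|t t' IHt IHt']; last first.
  by rewrite tmulDr !linearD /= tmulDr IHt IHt'.
by rewrite tmulE !tmapE tmulE rmorphM.
Qed.

Let tmap_star (s : tens H H) : tmap pi idfun (tstar s) = tstar (tmap pi idfun s).
Proof.
elim/tens_ind: s => [a b|s s' IHs IHs'].
  by rewrite tstarE !tmapE tstarE; congr (_ ⊗ _); exact: cqg_star.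
by rewrite tstarD !linearD /= tstarD IHs IHs'.
Qed.

Lemma lcoinvariant_subalg_closed : subalg_closed lcoinvariant.
Proof.
split=> [|a g h /lcoinvariantP Pg /lcoinvariantP Ph|g h /lcoinvariantP Pg /lcoinvariantP Ph];
  apply/lcoinvariantP.
- by rewrite comult1 tmapE rmorph1.
- by rewrite !linearP /= Pg Ph -pureZr -pureDr.
- by rewrite comultM tmapM Pg Ph tmulE mulr1.
Qed.
HB.instance Definition _ :=
  GRing.isSubalgClosed.Build C H lcoinvariant lcoinvariant_subalg_closed.

Lemma lcoinvariant_star h : h \in lcoinvariant -> star h \in lcoinvariant.
Proof.
move=> /lcoinvariantP Ph; apply/lcoinvariantP.
by rewrite comult_star tmap_star Ph tstarE star1.
Qed.

(** For a normal morphism the two sets of coinvariants agree; the Hopf kernel is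
    built from the left one, which is a *-subalgebra of [H] in any case. *)
Record hopf_kernel := HopfKernel {
  hopf_kernel_val :> H;
  hopf_kernelP : hopf_kernel_val \in lcoinvariant
}.
HB.instance Definition _ := [isSub for hopf_kernel_val].
HB.instance Definition _ := [Choice of hopf_kernel by <:].
HB.instance Definition _ := [SubChoice_isSubAlgebra of hopf_kernel by <:].

Definition hopf_kernel_star (h : hopf_kernel) : hopf_kernel :=
  HopfKernel (lcoinvariant_star (hopf_kernelP h)).

Lemma hopf_kernel_starD : {morph hopf_kernel_star : x y / x + y}.
Proof. by move=> x y; apply: val_inj; rewrite /= starD. Qed.
Lemma hopf_kernel_starZ (c : C) x :
  hopf_kernel_star (c *: x) = c^* *: hopf_kernel_star x.
Proof. by apply: val_inj; rewrite /= starZ. Qed.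
Lemma hopf_kernel_starM x y :
  hopf_kernel_star (x * y) = hopf_kernel_star y * hopf_kernel_star x.
Proof. by apply: val_inj; rewrite /= starM. Qed.
Lemma hopf_kernel_starK : involutive hopf_kernel_star.
Proof. by move=> x; apply: val_inj; rewrite /= starK. Qed.
HB.instance Definition _ := isStarAlgebra.Build C hopf_kernel
  hopf_kernel_starD hopf_kernel_starZ hopf_kernel_starM hopf_kernel_starK.
End HopfKernel.

Section ResiduallyFiniteDimensional.
Variables (C : numClosedFieldType) (A : starAlgType C).

Definition is_star_rep (V : vectType C) (dot : {dot V for Num.conj})
    (rho : {linear A -> 'End(V)}) :=
  [/\ rho 1 = \1%VF, forall a b, rho (a * b) = (rho a \o rho b)%VF &
      forall a v w, dot (rho (star a) v) w = dot v (rho a w)].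

Definition RFD := forall a : A, a != 0 ->
  exists (V : vectType C) (dot : {dot V for Num.conj})
         (rho : {linear A -> 'End(V)}),
    is_star_rep dot rho /\ rho a != 0.
End ResiduallyFiniteDimensional.
Arguments RFD {C} A.

Section GroupAlgebra.
Variables (C : numClosedFieldType) (G : finGroupType).
Implicit Types x y z : G.

(** The element [\sum_x f x *: delta x] is encoded by its coefficients; the
    product is the convolution (not the pointwise product of [{ffun G -> C}]). *)
Definition group_algebra : Type := {ffun G -> C^o}.
HB.instance Definition _ := GRing.Lmodule.on group_algebra.
Implicit Types f g h : group_algebra.

Definition delta x : group_algebra := [ffun y => (y == x)%:R].

Definition ga_mul f g : group_algebra :=
  [ffun x => \sum_y f y * g (y^-1 * x)%g].

Lemma ga_mulA : associative ga_mul.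
Proof.
move=> f g h; apply/ffunP => x; rewrite !ffunE.
under eq_bigr => y _ do rewrite ffunE big_distrr /=.
under [RHS]eq_bigr => y _ do rewrite ffunE big_distrl /=.
rewrite [RHS]exchange_big /=; apply: eq_bigr => y _.
rewrite [RHS](reindex_inj (mulgI y)) /=; apply: eq_bigr => z _.
by rewrite mulKg invMg mulgA mulrA.
Qed.
Lemma ga_mul1l : left_id (delta 1%g) ga_mul.
Proof.
move=> f; apply/ffunP => x; rewrite ffunE (bigD1 1%g) //= ffunE eqxx mul1r invg1 mul1g.
by rewrite big1 ?addr0 // => y /negPf y1; rewrite ffunE y1 mul0r.
Qed.
Lemma ga_mul1r : right_id (delta 1%g) ga_mul.
Proof.
move=> f; apply/ffunP => x; rewrite ffunE (bigD1 x) //= ffunE mulVg eqxx mulr1.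
rewrite big1 ?addr0 // => y /negPf yx; rewrite ffunE -eq_mulVg1 yx.
by rewrite mulr0.
Qed.
Lemma ga_mulDl : left_distributive ga_mul +%R.
Proof.
move=> f g h; apply/ffunP => x; rewrite !ffunE -big_split /=.
by apply: eq_bigr => y _; rewrite ffunE mulrDl.
Qed.
Lemma ga_mulDr : right_distributive ga_mul +%R.
Proof.
move=> f g h; apply/ffunP => x; rewrite !ffunE -big_split /=.
by apply: eq_bigr => y _; rewrite ffunE mulrDr.
Qed.
Lemma ga_1_neq0 : delta 1%g != 0.
Proof.
apply/eqP => /ffunP/(_ 1%g); rewrite !ffunE eqxx; exact/eqP/oner_neq0.
Qed.
HB.instance Definition _ := GRing.Zmodule_isNzRing.Build group_algebra
  ga_mulA ga_mul1l ga_mul1r ga_mulDl ga_mulDr ga_1_neq0.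

Lemma ga_scaleAl (a : C) f g : a *: (f * g) = (a *: f) * g.
Proof.
apply/ffunP => x; rewrite !ffunE [LHS]mulr_sumr.
by apply: eq_bigr => y _; rewrite !ffunE [LHS]mulrA.
Qed.
HB.instance Definition _ :=
  GRing.Lmodule_isLalgebra.Build C group_algebra ga_scaleAl.

Lemma ga_scaleAr (a : C) f g : a *: (f * g) = f * (a *: g).
Proof.
apply/ffunP => x; rewrite !ffunE [LHS]mulr_sumr.
by apply: eq_bigr => y _; rewrite !ffunE [LHS]mulrCA.
Qed.
HB.instance Definition _ :=
  GRing.Lalgebra_isAlgebra.Build C group_algebra ga_scaleAr.

Lemma gaE f : f = \sum_x f x *: delta x.
Proof.
apply/ffunP => x; rewrite sum_ffunE (bigD1 x) //= !ffunE eqxx [_ *: _]mulr1.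
rewrite big1 ?addr0 // => y /negPf yx.
by rewrite !ffunE eq_sym yx [_ *: _]mulr0.
Qed.

Lemma deltaM x y : delta x * delta y = delta (x * y)%g.
Proof.
apply/ffunP => z; rewrite !ffunE (bigD1 x) //= !ffunE eqxx mul1r.
rewrite big1 ?addr0 => [|t /negPf tx]; last by rewrite ffunE tx mul0r.
by rewrite -(inj_eq (mulgI x)) mulKVg.
Qed.

Definition ga_ext (W : lmodType C) (phi : G -> W) f : W := \sum_x f x *: phi x.

Lemma ga_ext_is_linear (W : lmodType C) (phi : G -> W) : linear (ga_ext phi).
Proof.
move=> a f g; rewrite /ga_ext scaler_sumr -big_split /=.
by apply: eq_bigr => x _; rewrite !ffunE scalerDl scalerA.
Qed.
HB.instance Definition _ (W : lmodType C) (phi : G -> W) :=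
  GRing.isLinear.Build C group_algebra W *:%R (ga_ext phi) (ga_ext_is_linear phi).

Lemma ga_extE (W : lmodType C) (phi : G -> W) x : ga_ext phi (delta x) = phi x.
Proof.
rewrite /ga_ext (bigD1 x) //= ffunE eqxx scale1r big1 ?addr0 // => y /negPf yx.
by rewrite ffunE yx scale0r.
Qed.

Lemma ga_eq_linear (W : lmodType C) (L M : group_algebra -> W) :
  linear L -> linear M -> (forall x, L (delta x) = M (delta x)) -> L =1 M.
Proof.
move=> linL linM LM f.
have E (N : group_algebra -> W) : linear N -> N f = \sum_x f x *: N (delta x).
  move=> linN; pose N' := GRing.isLinear.Build C group_algebra W *:%R N linN.
  pose N'' : {linear group_algebra -> W} := HB.pack N N'.
  rewrite {1}[f]gaE -[LHS]/(N'' _) linear_sum.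
  by apply: eq_bigr => x _; rewrite linearZ.
by rewrite !E //; apply: eq_bigr => x _; rewrite LM.
Qed.

Definition ga_star f : group_algebra := [ffun x => (f x^-1%g)^*].

Lemma ga_starE x : ga_star (delta x) = delta x^-1%g.
Proof.
by apply/ffunP => y; rewrite !ffunE conjC_nat -(inj_eq invg_inj) invgK.
Qed.
Lemma ga_starD : {morph ga_star : f g / f + g}.
Proof. by move=> f g; apply/ffunP => x; rewrite !ffunE rmorphD. Qed.
Lemma ga_starZ (a : C) f : ga_star (a *: f) = a^* *: ga_star f.
Proof. by apply/ffunP => x; rewrite !ffunE [LHS]rmorphM. Qed.
Lemma ga_starM f g : ga_star (f * g) = ga_star g * ga_star f.
Proof.
apply/ffunP => x; rewrite !ffunE rmorph_sum /=.
rewrite (reindex_inj (mulgI x^-1%g)) /=; apply: eq_bigr => y _.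
by rewrite !ffunE rmorphM mulrC !invMg !invgK mulgK.
Qed.
Lemma ga_starK : involutive ga_star.
Proof. by move=> f; apply/ffunP => x; rewrite !ffunE invgK conjCK. Qed.
HB.instance Definition _ := isStarAlgebra.Build C group_algebra
  ga_starD ga_starZ ga_starM ga_starK.

Definition ga_comult : group_algebra -> tens group_algebra group_algebra :=
  ga_ext (fun x => delta x ⊗ delta x).
Definition ga_counit : group_algebra -> C := ga_ext (fun=> 1 : C^o).
Definition ga_antipode : group_algebra -> group_algebra :=
  ga_ext (fun x => delta x^-1%g).
HB.instance Definition _ := GRing.Linear.on ga_comult.
HB.instance Definition _ :=
  GRing.isLinear.Build C group_algebra C *%R ga_counit
    (ga_ext_is_linear (fun=> 1 : C^o)).
HB.instance Definition _ := GRing.Linear.on ga_antipode.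

Lemma ga_comultE x : ga_comult (delta x) = delta x ⊗ delta x.
Proof. exact: ga_extE. Qed.
Lemma ga_counitE x : ga_counit (delta x) = 1.
Proof. exact: (@ga_extE C^o). Qed.
Lemma ga_antipodeE x : ga_antipode (delta x) = delta x^-1%g.
Proof. exact: ga_extE. Qed.

Lemma ga_coassoc f :
  tassoc (tmap ga_comult idfun (ga_comult f)) =
  tmap idfun ga_comult (ga_comult f).
Proof.
move: f; apply: ga_eq_linear => [a g h|a g h|x].
- by rewrite [ga_comult _]linearP [tmap _ _ _]linearP [LHS]linearP.
- by rewrite [ga_comult _]linearP [LHS]linearP.
- by rewrite ga_comultE !tmapE /= ga_comultE tassocE.
Qed.

Lemma tlift_counitl_bil : semibilinear idfun
  (fun f g : group_algebra => ga_counit f *: g).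
Proof.
split=> [g f f'|f g g'|a f g|a f g].
- by rewrite linearD scalerDl.
- by rewrite scalerDr.
- by rewrite linearZ scalerA.
- by rewrite !scalerA mulrC.
Qed.

Lemma tlift_counitr_bil : semibilinear idfun
  (fun f g : group_algebra => ga_counit g *: f).
Proof. by case: tlift_counitl_bil. Qed.

Lemma ga_counitl f : tlift (fun g h => ga_counit g *: h) (ga_comult f) = f.
Proof.
move: f; apply: (ga_eq_linear (M := idfun)) => [a g h|//|x].
  by rewrite [ga_comult _]linearP (tlift_forP tlift_counitl_bil).
by rewrite ga_comultE (tlift_forE tlift_counitl_bil) ga_counitE scale1r.
Qed.

Lemma ga_counitr f : tlift (fun g h => ga_counit h *: g) (ga_comult f) = f.
Proof.
move: f; apply: (ga_eq_linear (M := idfun)) => [a g h|//|x].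
  by rewrite [ga_comult _]linearP (tlift_forP tlift_counitr_bil).
by rewrite ga_comultE (tlift_forE tlift_counitr_bil) ga_counitE scale1r.
Qed.

Lemma ga_comult1 : ga_comult 1 = 1 ⊗ 1.
Proof. exact: ga_comultE. Qed.

Lemma ga_comultM f g : ga_comult (f * g) = tmul (ga_comult f) (ga_comult g).
Proof.
move: f; apply: (ga_eq_linear (L := fun f => ga_comult (f * g))
  (M := fun f => tmul (ga_comult f) (ga_comult g))) => [a h h'|a h h'|x].
- by rewrite mulrDl -scalerAl [LHS]linearP.
- by rewrite [ga_comult _]linearP tmulDl tmulZl.
move: g; apply: (ga_eq_linear (L := fun g => ga_comult (delta x * g))
  (M := fun g => tmul (ga_comult (delta x)) (ga_comult g))) => [a h h'|a h h'|y].
- by rewrite mulrDr -scalerAr [LHS]linearP.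
- by rewrite [ga_comult (_ + _)]linearP tmulDr tmulZr.
by rewrite deltaM !ga_comultE tmulE deltaM.
Qed.

Lemma ga_counit1 : ga_counit 1 = 1.
Proof. exact: ga_counitE. Qed.

Lemma ga_counitM f g : ga_counit (f * g) = ga_counit f * ga_counit g.
Proof.
move: f; apply: (ga_eq_linear (L := fun f => ga_counit (f * g) : C^o)
  (M := fun f => ga_counit f * ga_counit g)) => [a h h'|a h h'|x].
- by rewrite mulrDl -scalerAl [LHS]linearP.
- by rewrite [ga_counit (_ + _)]linearP mulrDl -mulrA.
move: g; apply: (ga_eq_linear (L := fun g => ga_counit (delta x * g) : C^o)
  (M := fun g => ga_counit (delta x) * ga_counit g)) => [a h h'|a h h'|y].
- by rewrite mulrDr -scalerAr [LHS]linearP.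
- by rewrite [ga_counit (_ + _)]linearP mulrDr mulrCA.
by rewrite deltaM !ga_counitE mulr1.
Qed.

Lemma tlift_antipodel_bil : semibilinear idfun
  (fun f g : group_algebra => ga_antipode f * g).
Proof.
split=> [g f f'|f g g'|a f g|a f g].
- by rewrite linearD mulrDl.
- by rewrite mulrDr.
- by rewrite linearZ scalerAl.
- by rewrite scalerAr.
Qed.

Lemma tlift_antipoder_bil : semibilinear idfun
  (fun f g : group_algebra => f * ga_antipode g).
Proof.
split=> [g f f'|f g g'|a f g|a f g].
- by rewrite mulrDl.
- by rewrite linearD mulrDr.
- by rewrite scalerAl.
- by rewrite linearZ scalerAr.
Qed.

Let counit_lin : linear (fun f => ga_counit f *: 1 : group_algebra).
Proof. by move=> a f g; rewrite linearP scalerDl scalerA. Qed.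

Lemma ga_antipodel f :
  tlift (fun g h => ga_antipode g * h) (ga_comult f) = ga_counit f *: 1.
Proof.
move: f; apply: (ga_eq_linear _ counit_lin) => [a g h|x].
  by rewrite [ga_comult _]linearP (tlift_forP tlift_antipodel_bil).
rewrite ga_comultE (tlift_forE tlift_antipodel_bil) ga_counitE scale1r.
by rewrite ga_antipodeE deltaM mulVg.
Qed.

Lemma ga_antipoder f :
  tlift (fun g h => g * ga_antipode h) (ga_comult f) = ga_counit f *: 1.
Proof.
move: f; apply: (ga_eq_linear _ counit_lin) => [a g h|x].
  by rewrite [ga_comult _]linearP (tlift_forP tlift_antipoder_bil).
rewrite ga_comultE (tlift_forE tlift_antipoder_bil) ga_counitE scale1r.
by rewrite ga_antipodeE deltaM mulgV.
Qed.

Lemma ga_comult_star f : ga_comult (star f) = tstar (ga_comult f).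
Proof.
rewrite -[f in LHS]starK -[f in RHS]starK; move: (star f) => {}f; rewrite starK.
move: f; apply: (ga_eq_linear (M := fun f => tstar (ga_comult (star f))))
  => [a g h|a g h|x].
- by rewrite linearP.
- by rewrite starD starZ [ga_comult _]linearP tstarD tstarZ conjCK.
by rewrite [star _]ga_starE !ga_comultE tstarE [star _]ga_starE invgK.
Qed.

Lemma ga_counit_star f : ga_counit (star f) = (ga_counit f)^*.
Proof.
rewrite -[f in LHS]starK -[f in RHS]starK; move: (star f) => {}f; rewrite starK.
move: f; apply: (ga_eq_linear (L := ga_counit : _ -> C^o)
  (M := fun f => (ga_counit (star f))^*)) => [a g h|a g h|x].
- by rewrite linearP.
- by rewrite starD starZ [ga_counit _]linearP /= rmorphD rmorphM /= conjCK.
by rewrite [star _]ga_starE !ga_counitE rmorph1.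
Qed.

HB.instance Definition _ := isHopfStarAlgebra.Build C group_algebra
  ga_coassoc ga_counitl ga_counitr ga_comult1 ga_comultM ga_counit1 ga_counitM
  ga_antipodel ga_antipoder ga_comult_star ga_counit_star.

(** The coefficient of the one-dimensional comodule [v |-> v ⊗ delta x] is
    [delta x]. *)
Definition scalar_dot (u v : C^o) : C := u * v^*.

Lemma scalar_dot_is_bilinear :
  bilinear_for *%R (Num.conj \; *%R) scalar_dot.
Proof.
split=> [u a v w|u a v w]; rewrite /scalar_dot /=.
  by rewrite mulrDl mulrA.
by rewrite rmorphD rmorphM mulrDr mulrCA.
Qed.
HB.instance Definition _ := bilinear_isBilinear.Build C C^o C^o C
  *%R (Num.conj \; *%R) scalar_dot scalar_dot_is_bilinear.

Lemma scalar_dot_hermitian u v :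
  scalar_dot u v = (-1) ^+ false * (scalar_dot v u)^*.
Proof. by rewrite mul1r rmorphM /= conjCK mulrC. Qed.
HB.instance Definition _ := isHermitianSesquilinear.Build C C^o false Num.conj
  scalar_dot scalar_dot_hermitian.

Lemma scalar_dot_gt0 u : u != 0 -> 0 < scalar_dot u u.
Proof. by move=> u0; rewrite /scalar_dot -normCK exprn_gt0 ?normr_gt0. Qed.
HB.instance Definition _ := isDotProduct.Build C C^o scalar_dot scalar_dot_gt0.

Definition delta_comodule x (v : C^o) : tens C^o group_algebra := v ⊗ delta x.

Lemma delta_comodule_is_linear x : linear (delta_comodule x).
Proof. by move=> a u v; rewrite /delta_comodule pureDl pureZl. Qed.
HB.instance Definition _ x := GRing.isLinear.Build C C^o
  (tens C^o group_algebra) *:%R (delta_comodule x) (delta_comodule_is_linear x).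

Lemma delta_unitary_coef x : unitary_coef (delta x : group_algebra).
Proof.
exists C^o, scalar_dot, (delta_comodule x); split.
- split=> v; rewrite /delta_comodule.
    by rewrite !tmapE /= /delta_comodule tassocE [comult _]ga_comultE.
  rewrite tlift_forE ?[counit _]ga_counitE ?scale1r //.
  split=> [g u u'|u g g'|a u g|a u g].
  - by rewrite scalerDr.
  - by rewrite linearD scalerDl.
  - by rewrite !scalerA mulrC.
  - by rewrite linearZ scalerA.
- move=> v w; rewrite /delta_comodule.
  have bilw u g : semibilinear Num.conj
      (fun (w0 : C^o) w1 => scalar_dot u w0 *: (star w1 * g : group_algebra)).
    split=> [h y y'|y h h'|a y h|a y h].
    - by rewrite linearDr scalerDl.
    - by rewrite starD mulrDl scalerDr.
    - by rewrite linearZr_LR scalerA.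
    - by rewrite starZ -scalerAl !scalerA mulrC.
  rewrite tlift_forE; last first.
    split=> [h y y'|y h h'|a y h|a y h]; rewrite !(tlift_forE (bilw _ _)).
    - by rewrite linearDl scalerDl.
    - by rewrite mulrDr scalerDr.
    - by rewrite linearZl_LR scalerA.
    - by rewrite -scalerAr !scalerA mulrC.
  rewrite (tlift_forE (bilw _ _)) [star _]ga_starE [_ * _]deltaM mulVg.
  by [].
- exists 1, 1; rewrite /matrix_coef /delta_comodule tlift_forE.
    by rewrite /= [scalar_dot 1 1]mul1r conjC1 scale1r.
  split=> [h y y'|y h h'|a y h|a y h].
  - by rewrite linearDl scalerDl.
  - by rewrite scalerDr.
  - by rewrite linearZl_LR scalerA.
  - by rewrite !scalerA mulrC.
Qed.

Lemma ga_cqg_span f : exists s : seq (C * group_algebra),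
  (forall p, p \in s -> unitary_coef p.2) /\ f = \sum_(p <- s) p.1 *: p.2.
Proof.
exists [seq (f x, delta x) | x <- index_enum G]; split=> [p /mapP[x _ ->]|].
  exact: delta_unitary_coef.
by rewrite big_map [LHS]gaE.
Qed.
HB.instance Definition _ := isCQG.Build C group_algebra ga_cqg_span.
End GroupAlgebra.

(* Main.v *)
(** Pushing the coproduct of [H] along [pi] makes [H] a [Gamma]-graded algebra,
    and by normality [P] is its degree one part; let [E : H -> P] be the
    projection.  A comodule of [H] is graded as well, and a unit vector of degree
    [g^-1] has, in an orthonormal basis, coefficients [y_i] of degree [g^-1] with
    [\sum_i y_i^* y_i = 1]; surjectivity of [pi] provides such a vector for every
    [g].  Collecting all the [y_i^*] gives a finite family [x_i] in [H] with
    [\sum_i E (a x_i) E (x_i^* b) = E (a b)].  A *-representation [rho] of [P]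
    on [V] is then induced to [H] by the matrices [rho (E (x_i^* a x_j))]; on the
    complement of the projection given by [a = 1] one lets [H] act through the
    counit.  If [a != 0] then some [E (x_i^* a x_j)] is nonzero. *)
From HB Require Import structures.
Require Import Defs.
From mathcomp Require Import all_boot all_order all_fingroup all_algebra.
From mathcomp Require Import complex reals.
From mathcomp Require Import sesquilinear boolp.

Set Implicit Arguments.
Unset Strict Implicit.
Unset Printing Implicit Defensive.

Import Order.TTheory GRing.Theory Num.Theory.
Local Open Scope ring_scope.

(** * Slicing tensors by linear functionals *)

Lemma tens_ext (C : numClosedFieldType) (U V : lmodType C) (W : zmodType)
    (f g : {additive tens U V -> W}) :
  (forall u v, f (u ⊗ v) = g (u ⊗ v)) -> f =1 g.
Proof.
by move=> fg; elim/tens_ind=> [u v|s t IHs IHt]; rewrite ?fg // !raddfD IHs IHt.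
Qed.

Section Slices.
Variables (C : numClosedFieldType) (U V : lmodType C).

Definition slicel (phi : U -> C) : tens U V -> V := tlift (fun u v => phi u *: v).
Definition slicer (phi : V -> C) : tens U V -> U := tlift (fun u v => phi v *: u).

Section Slicel.
Variable phi : {scalar U}.

Lemma slicel_bil : semibilinear idfun (fun (u : U) (v : V) => phi u *: v).
Proof.
split=> [v u u'|u v v'|a u v|a u v].
- by rewrite linearD scalerDl.
- by rewrite scalerDr.
- by rewrite linearZ scalerA.
- by rewrite !scalerA mulrC.
Qed.

Lemma slicelE u v : slicel phi (u ⊗ v) = phi u *: v.
Proof. exact: (tlift_forE slicel_bil). Qed.
Lemma slicel_is_linear : linear (slicel phi).
Proof. by move=> a s t; rewrite /slicel (tlift_forP slicel_bil). Qed.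
HB.instance Definition _ := GRing.isLinear.Build C (tens U V) V *:%R
  (slicel phi) slicel_is_linear.
Lemma slicelD : {morph slicel phi : s t / s + t}. Proof. exact: linearD. Qed.
End Slicel.

Section Slicer.
Variable phi : {scalar V}.

Lemma slicer_bil : semibilinear idfun (fun (u : U) (v : V) => phi v *: u).
Proof.
split=> [v u u'|u v v'|a u v|a u v].
- by rewrite scalerDr.
- by rewrite linearD scalerDl.
- by rewrite !scalerA mulrC.
- by rewrite linearZ scalerA.
Qed.

Lemma slicerE u v : slicer phi (u ⊗ v) = phi v *: u.
Proof. exact: (tlift_forE slicer_bil). Qed.
Lemma slicer_is_linear : linear (slicer phi).
Proof. by move=> a s t; rewrite /slicer (tlift_forP slicer_bil). Qed.
HB.instance Definition _ := GRing.isLinear.Build C (tens U V) U *:%R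
  (slicer phi) slicer_is_linear.
Lemma slicerD : {morph slicer phi : s t / s + t}. Proof. exact: linearD. Qed.
End Slicer.

Lemma scalar_slice (phi : {scalar U}) (psi : {scalar V}) t :
  psi (slicel phi t) = phi (slicer psi t).
Proof.
elim/tens_ind: t => [u v|s t IHs IHt]; last first.
  by rewrite slicelD slicerD !linearD /= IHs IHt.
by rewrite slicelE slicerE !linearZ /= mulrC.
Qed.
End Slices.

(** Fixing the right leg gives a linear map, so that [tens_ext] applies a second time, to the inner
    factor of a nested tensor product. *)
Definition purer (C : numClosedFieldType) (U V : lmodType C) (v : V) (u : U) :
  tens U V := u ⊗ v.
Lemma purer_is_linear (C : numClosedFieldType) (U V : lmodType C) (v : V) :
  linear (@purer C U V v).
Proof. by move=> a u u'; rewrite /purer pureDl pureZl. Qed.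
HB.instance Definition _ (C : numClosedFieldType) (U V : lmodType C) (v : V) :=
  GRing.isLinear.Build C U (tens U V) *:%R (purer v) (purer_is_linear v).

Section SliceTheory.
Variables (C : numClosedFieldType) (U V W U' V' : lmodType C).

Lemma slicer_tmap (f : {linear U -> U'}) (g : {linear V -> V'})
    (phi : {scalar V'}) t :
  slicer phi (tmap f g t) = f (slicer (phi \o g) t).
Proof.
move: t; apply: (@tens_ext _ _ _ _ (slicer phi \o tmap f g)
  (f \o slicer (phi \o g))) => u v /=.
by rewrite tmapE !slicerE linearZ.
Qed.

Lemma slicel_tmap (g : {linear V -> V'}) (phi : {scalar U}) t :
  slicel phi (tmap idfun g t) = g (slicel phi t).
Proof.
move: t; apply: (@tens_ext _ _ _ _ (slicel phi \o tmap idfun g)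
  (g \o slicel phi)) => u v /=.
by rewrite tmapE !slicelE linearZ.
Qed.

Lemma slicer_tassoc (phi : {scalar V}) (psi : {scalar W}) (t : tens (tens U V) W) :
  slicer (phi \o slicer psi) (tassoc t) = slicer phi (slicer psi t).
Proof.
move: t; apply: (@tens_ext _ _ _ _ (slicer (phi \o slicer psi) \o @tassoc _ _ _ _)
  (slicer phi \o slicer psi)) => p w /=; move: p.
apply: (@tens_ext _ _ _ _ (slicer (phi \o slicer psi) \o @tassoc _ _ _ _ \o purer w)
  (slicer phi \o slicer psi \o purer w)) => u v /=.
by rewrite /purer tassocE !slicerE /= slicerE !linearZ /= slicerE scalerA.
Qed.

Lemma slicer_slicel (phi : {scalar U}) (psi : {scalar W}) (t : tens (tens U V) W) :
  slicer psi (slicel phi (tassoc t)) = slicel phi (slicer psi t).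
Proof.
move: t; apply: (@tens_ext _ _ _ _ (slicer psi \o slicel phi \o @tassoc _ _ _ _)
  (slicel phi \o slicer psi)) => p w /=; move: p.
apply: (@tens_ext _ _ _ _ (slicer psi \o slicel phi \o @tassoc _ _ _ _ \o purer w)
  (slicel phi \o slicer psi \o purer w)) => u v /=.
by rewrite /purer tassocE slicelE slicerE !linearZ /= slicelE slicerE !scalerA mulrC.
Qed.
End SliceTheory.

(** * The grading of [H] and its comodules by [G] *)

Section Grading.
Variables (C : numClosedFieldType) (G : finGroupType) (H : cqgAlgType C).
Local Notation K := (group_algebra C G).
Variable pi : cqgMorphism H K.
Implicit Types (x y : G) (h k : H).

Definition gacoef x (f : K) : C := (f : {ffun G -> C^o}) x.
Lemma gacoef_is_scalar x : scalar (gacoef x).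
Proof. by move=> a f g; rewrite /gacoef !ffunE. Qed.
HB.instance Definition _ x := GRing.isLinear.Build C K C *%R (gacoef x)
  (gacoef_is_scalar x).

Lemma slicer_gacoef x (f : K) : slicer (gacoef x) (comult f) = gacoef x f *: delta C x.
Proof.
move: f; apply: (ga_eq_linear (L := slicer (gacoef x) \o comult)) => [|a f g|y] /=.
- exact: linearP.
- by rewrite linearP scalerDl scalerA.
rewrite [comult _]ga_comultE slicerE /= /gacoef ffunE.
by case: eqP => [->|_] //; rewrite !scale0r.
Qed.

Definition picoef x : H -> C := gacoef x \o pi.
HB.instance Definition _ x := GRing.Linear.on (picoef x).

Lemma picoefM x h k :
  picoef x (h * k) = \sum_y picoef y h * picoef (y^-1 * x)%g k.
Proof. by rewrite /picoef /= rmorphM /gacoef ffunE. Qed.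

Lemma picoef_star x h : picoef x (star h) = (picoef x^-1%g h)^*.
Proof. by rewrite /picoef /= cqg_star /gacoef ffunE. Qed.

Lemma sum_picoef h : \sum_x picoef x h = counit h.
Proof.
rewrite -(cqg_counit pi) [RHS](_ : _ = ga_counit (pi h)) // /ga_counit /ga_ext.
by apply: eq_bigr => x _; rewrite [_ *: _]mulr1.
Qed.

Lemma tmap_pi (V : lmodType C) (t : tens V H) :
  tmap idfun pi t = \sum_x slicer (picoef x) t ⊗ delta C x.
Proof.
elim/tens_ind: t => [v h|s t IHs IHt]; last first.
  rewrite [LHS]linearD /= IHs IHt -big_split /=.
  by apply: eq_bigr => x _; rewrite slicerD pureDl.
rewrite tmapE /= [pi h]gaE (big_morph _ (pureDr _) (id1 := 0)); last first.
  by rewrite -(scale0r (0 : K)) pureZr scale0r.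
by apply: eq_bigr => x _; rewrite slicerE pureZl pureZr.
Qed.

Lemma slicer_picoefM x (s t : tens H H) :
  slicer (picoef x) (tmul s t) =
  \sum_y slicer (picoef y) s * slicer (picoef (y^-1 * x)%g) t.
Proof.
elim/tens_ind: s => [a b|s s' IHs IHs']; last first.
  rewrite tmulDl slicerD IHs IHs' -big_split /=.
  by apply: eq_bigr => y _; rewrite slicerD mulrDl.
elim/tens_ind: t => [a' b'|t t' IHt IHt']; last first.
  rewrite tmulDr slicerD IHt IHt' -big_split /=.
  by apply: eq_bigr => y _; rewrite slicerD mulrDr.
rewrite tmulE slicerE /= picoefM scaler_suml; apply: eq_bigr => y _.
by rewrite !slicerE /= -scalerAl -scalerAr scalerA.
Qed.

Lemma slicer_picoef_star x (t : tens H H) :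
  slicer (picoef x) (tstar t) = star (slicer (picoef x^-1%g) t).
Proof.
elim/tens_ind: t => [a b|s t IHs IHt]; last first.
  by rewrite tstarD !slicerD starD IHs IHt.
by rewrite tstarE !slicerE /= starZ picoef_star.
Qed.

(** [pi] preserves the counit, which on the group algebra adds up all coefficients; hence the
    homogeneous components of a vector sum to that vector. *)
Lemma slicer_counit (V : lmodType C) (t : tens V H) :
  \sum_x slicer (picoef x) t = slicer counit t.
Proof.
elim/tens_ind: t => [v h|s t IHs IHt]; last first.
  rewrite [RHS]slicerD -IHs -IHt -big_split /=.
  by apply: eq_bigr => x _; rewrite slicerD.
rewrite slicerE /= -sum_picoef scaler_suml.
by apply: eq_bigr => x _; rewrite slicerE.
Qed.

(* The degree [x] component [pi (v_1) x *: v_0] of [v], where [rho v = v_0 ⊗ v_1]. *)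
Definition hcomp (V : lmodType C) (rho : {linear V -> tens V H}) x : V -> V :=
  slicer (picoef x) \o rho.
HB.instance Definition _ V rho x := GRing.Linear.on (@hcomp V rho x).
Local Notation E := (hcomp comult).

Lemma pi_hcomp x h : pi (E x h) = picoef x h *: delta C x.
Proof.
by rewrite /= -slicer_gacoef cqg_comult (slicer_tmap pi pi).
Qed.

Lemma picoef_hcomp x y h : picoef x (E y h) = if x == y then picoef y h else 0.
Proof.
rewrite -[LHS]/(gacoef x (pi (E y h))) pi_hcomp linearZ /= /gacoef ffunE.
by case: eqP => _; rewrite ?mulr1 ?mulr0.
Qed.

Section Comodule.
Variables (V : lmodType C) (rho : {linear V -> tens V H}).
Hypothesis rhoA : forall v,
  tassoc (tmap rho idfun (rho v)) = tmap idfun comult (rho v).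

(** Coassociativity moves both slices to the coproduct of the second leg, where [picoef_hcomp] keeps
    only equal degrees: the components are orthogonal idempotents. *)
Lemma hcomp_comp x y v :
  hcomp rho x (hcomp rho y v) = if x == y then hcomp rho y v else 0.
Proof.
have -> : hcomp rho x (hcomp rho y v) =
    slicer (picoef x \o slicer (picoef y)) (tassoc (tmap rho idfun (rho v))).
  by rewrite slicer_tassoc slicer_tmap.
rewrite rhoA slicer_tmap /= /hcomp /=.
elim/tens_ind: (rho v) => [a h|s t IHs IHt]; last first.
  by rewrite !slicerD IHs IHt; case: ifP; rewrite ?addr0.
rewrite !slicerE -[X in X *: _]/(picoef x (E y h)) picoef_hcomp.
by case: eqP => // _; rewrite scale0r.
Qed.

Lemma sum_hcomp v :
  (forall v, tlift (fun v0 v1 => counit v1 *: v0) (rho v) = v) ->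
  \sum_x hcomp rho x v = v.
Proof. by move=> rho1; rewrite slicer_counit [LHS]rho1. Qed.
End Comodule.

Lemma hcompM x h k : E x (h * k) = \sum_y E y h * E (y^-1 * x)%g k.
Proof. by rewrite /hcomp /= comultM slicer_picoefM. Qed.

Lemma hcomp_star x h : E x (star h) = star (E x^-1%g h).
Proof. by rewrite /hcomp /= comult_star slicer_picoef_star. Qed.

(** In the expansion [tmap_pi] only the component of degree [1] survives, and [delta C 1] is the
    unit of the group algebra. *)
Lemma hcomp_rcoinvariant h : E 1%g h \in rcoinvariant pi.
Proof.
apply/rcoinvariantP; rewrite tmap_pi (bigD1 1%g) //=.
rewrite (_ : slicer _ _ = E 1%g (E 1%g h)) // hcomp_comp ?eqxx; last exact: coassoc.
rewrite big1 ?addr0 // => x /negPf x1.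
rewrite (_ : slicer _ _ = E x (E 1%g h)) // hcomp_comp ?x1; last exact: coassoc.
by rewrite -(scale0r (0 : H)) pureZl scale0r.
Qed.
End Grading.

(** * Tensors with orthonormal left legs *)

Lemma tlift_for_sum (C : numClosedFieldType) (U V W : lmodType C)
    (sigma : {rmorphism C -> C}) (f : U -> V -> W) (I : Type) (r : seq I)
    (u : I -> U) (v : I -> V) :
  semibilinear sigma f ->
  tlift_for sigma f (\sum_(i <- r) u i ⊗ v i) = \sum_(i <- r) f (u i) (v i).
Proof.
move=> fbil; rewrite (big_morph _ (tlift_forD fbil) (id1 := 0)).
  by apply: eq_bigr => i _; rewrite tlift_forE.
by rewrite -(scale0r (0 : tens U V)) (tlift_forZ fbil) rmorph0 scale0r.
Qed.

Section Orthonormal.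
Variables (C : numClosedFieldType) (V : vectType C) (dot : {dot V for Num.conj}).
Variable W : lmodType C.

(* Gram-Schmidt on the left legs of the tensor. *)
Lemma orthonormal_tens (s : seq (V * W)) :
  exists n (e : 'I_n -> V) (y : 'I_n -> W),
    [/\ \sum_(p <- s) p.1 ⊗ p.2 = \sum_i e i ⊗ y i,
        forall i j, dot (e i) (e j) = (i == j)%:R &
        forall w, {in s, forall p, dot p.1 w = 0} -> forall i, dot (e i) w = 0].
Proof.
have [n] := ubnP (size s); elim: n s => // n IHn [|[v h] s] /= ltn.
  by exists 0, (fun=> 0), (fun=> 0); split=> [|[]|w _ []] //; rewrite big_nil big_ord0.
have [v0|v_neq0] := eqVneq v 0.
  have [//|m [e [y [se eP sorth]]]] := IHn s; exists m, e, y; split=> // [|w sw].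
    by rewrite big_cons v0 /= -(scale0r (0 : V)) pureZl scale0r add0r.
  by apply: sorth => p ps; apply: sw; rewrite inE ps orbT.
set N := sqrtC (dot v v).
have N_gt0 : 0 < N by rewrite sqrtC_gt0 neq0_dnorm_gt0.
have NK : N^-1 * N = 1 by rewrite mulVf ?gt_eqF.
pose u := N^-1 *: v.
have uu : dot u u = 1.
  rewrite linearZl_LR linearZr_LR /= fmorphV /= (CrealP (gtr0_real N_gt0)).
  by rewrite -(sqrtCK (dot v v)) -/N expr2 (mulrA _ N) NK mul1r NK.
pose s1 := [seq (p.1 - dot p.1 u *: u, p.2) | p <- s].
have [|m [e [y [se eP sorth]]]] := IHn s1; first by rewrite size_map.
(* The left legs of [s1] are orthogonal to [u]; the third clause of the induction hypothesis passes
   this on to the vectors [e i]. *)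
have eu i : dot (e i) u = 0.
  apply: sorth => _ /mapP[p _ ->] /=.
  by rewrite linearBl linearZl_LR /= uu mulr1 subrr.
have ue i : dot u (e i) = 0.
  by rewrite (@hermC _ _ _ _ dot) /= eu rmorph0 mulr0.
exists m.+1, (fun i => if unlift ord0 i is Some j then e j else u).
(* The coefficient of [u] gathers the norm of [v] and the projections onto [u] that were removed
   from [s]. *)
exists (fun i => if unlift ord0 i is Some j then y j
                 else N *: h + \sum_(p <- s) dot p.1 u *: p.2).
split=> [|i j|w sw i].
- rewrite big_cons big_ord_recl unlift_none.
  under [X in _ = _ + X]eq_bigr => i _ do rewrite liftK.
  rewrite -se big_map /= pureDr pureZr -pureZl scalerA mulrC NK scale1r -addrA.
  congr (_ + _); rewrite (big_morph _ (pureDr u) (id1 := 0)); last first.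
    by rewrite -(scale0r (0 : W)) pureZr scale0r.
  rewrite -big_split /=; apply: eq_bigr => p _.
  by rewrite pureZr -pureZl -pureDl addrC subrK.
- case: (unliftP ord0 i) => [i' ->|->]; case: (unliftP ord0 j) => [j' ->|->];
    by rewrite ?(inj_eq lift_inj).
- have uw : dot u w = 0.
    by rewrite linearZl_LR /= (sw (v, h)) ?mulr0 // inE eqxx.
  case: (unliftP ord0 i) => [i' _|_] //; apply: sorth => _ /mapP[p ps ->] /=.
  by rewrite linearBl linearZl_LR /= uw mulr0 subr0 sw // inE ps orbT.
Qed.
End Orthonormal.

(** * Homogeneous families with sum of [h * star h] equal to [1] *)

Section DegreeUnit.
Variables (C : numClosedFieldType) (G : finGroupType) (H : cqgAlgType C).
Variable pi : cqgMorphism H (group_algebra C G).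
Local Notation E := (hcomp pi comult).

(** The functional acts on the left leg and the grading on the right one, so they commute;
    coefficients of a homogeneous vector are thus homogeneous of its degree. *)
Lemma hcomp_matrix_coef (V : vectType C) (dot : {dot V for Num.conj})
    (rho : {linear V -> tens V H}) x v w :
  is_comodule rho ->
  E x (matrix_coef dot rho v w) = matrix_coef dot rho (hcomp pi rho x v) w.
Proof.
case=> rhoA _.
rewrite /hcomp /= -[matrix_coef _ _ _ _]/(slicel (applyr dot w) (rho v)).
rewrite -slicel_tmap -rhoA slicer_slicel slicer_tmap.
by [].
Qed.

(** Unitarity is applied to the pair [v], [v]; orthonormality removes the off-diagonal terms. *)
Lemma unitary_sum (V : vectType C) (dot : {dot V for Num.conj})
    (rho : {linear V -> tens V H}) v n (e : 'I_n -> V) (y : 'I_n -> H) :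
  is_unitary_comodule dot rho -> rho v = \sum_i e i ⊗ y i ->
  (forall i j, dot (e i) (e j) = (i == j)%:R) ->
  \sum_i star (y i) * y i = dot v v *: 1.
Proof.
move=> /(_ v v) <- rhov eP.
have bilw u g : semibilinear Num.conj
    (fun (w0 : V) w1 => dot u w0 *: (star w1 * g : H)).
  split=> [h x x'|x h h'|a x h|a x h].
  - by rewrite linearDr scalerDl.
  - by rewrite starD mulrDl scalerDr.
  - by rewrite linearZr_LR scalerA.
  - by rewrite starZ -scalerAl !scalerA mulrC.
rewrite {2}rhov tlift_for_sum; last first.
  split=> [h x x'|x h h'|a x h|a x h]; rewrite rhov !(tlift_for_sum _ _ _ (bilw _ _)).
  - by rewrite -big_split; apply: eq_bigr => i _; rewrite linearDl scalerDl.
  - by rewrite -big_split; apply: eq_bigr => i _; rewrite mulrDr scalerDr.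
  - by rewrite scaler_sumr; apply: eq_bigr => i _; rewrite linearZl_LR scalerA.
  - rewrite scaler_sumr; apply: eq_bigr => i _.
    by rewrite -scalerAr !scalerA mulrC.
apply: eq_bigr => i _; rewrite rhov (tlift_for_sum _ _ _ (bilw _ _)) (bigD1 i) //=.
rewrite eP eqxx scale1r big1 ?addr0 // => j /negPf ji.
by rewrite eP eq_sym ji scale0r.
Qed.

Lemma exists_degree_unit x : (forall f, exists h, pi h = f) ->
  exists s : seq H, {in s, forall h, E x h = h} /\ \sum_(h <- s) h * star h = 1.
Proof.
move=> pi_surj; have [h hE] := pi_surj (delta C x^-1%g).
have [s [sU hs]] := cqg_span h.
(* The coefficient of [pi h] at [x^-1] is [1], so it cannot vanish on every unitary coefficient in
   the expansion of [h]. *)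
have [p ps p_neq0] : exists2 p, p \in s & picoef pi x^-1%g p.2 != 0.
  apply/hasP/negPn/negP => /hasPn s0.
  have : picoef pi x^-1%g h = 0.
    rewrite hs linear_sum big_seq big1 // => p /s0 /negPn/eqP.
    by rewrite linearZ /= => ->; rewrite mulr0.
  move/eqP; rewrite /picoef /= hE /gacoef ffunE eqxx; exact/negP/oner_neq0.
have [V [dot [rho [rhoC rhoU [v [w pE]]]]]] := sU p ps.
pose v' := hcomp pi rho x^-1%g v.
(* By [scalar_slice], [picoef pi x^-1 p.2] is the inner product of [v'] with [w]. *)
have v'_neq0 : v' != 0.
  apply: contraNneq p_neq0 => v'0.
  rewrite pE -[matrix_coef _ _ _ _]/(slicel (applyr dot w) (rho v)) scalar_slice.
  by rewrite -[slicer _ _]/v' v'0 raddf0.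
have v'P : hcomp pi rho x^-1%g v' = v'.
  by rewrite hcomp_comp ?eqxx //; case: rhoC.
have [t vt] := tens_sum (rho v').
have [n [e [y [te eP _]]]] := orthonormal_tens dot t.
rewrite te in vt.
(* Orthonormality exhibits [y i] as a matrix coefficient of the homogeneous vector [v'], which gives
   it degree [x^-1]. *)
have yE i : matrix_coef dot rho v' (e i) = y i.
  rewrite -[LHS]/(slicel (applyr dot (e i)) (rho v')) vt linear_sum (bigD1 i) //=.
  rewrite slicelE /= eP eqxx scale1r big1 ?addr0 // => j /negPf ji.
  by rewrite slicelE /= eP ji scale0r.
have Ey i : E x^-1%g (y i) = y i.
  by rewrite -yE hcomp_matrix_coef // v'P.
have ysum := unitary_sum rhoU vt eP.
set N := sqrtC (dot v' v').
have N_gt0 : 0 < N by rewrite sqrtC_gt0 neq0_dnorm_gt0.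
(* The star turns degree [x^-1] into [x], and dividing by the norm of [v'] makes the sum [1]. *)
exists [seq N^-1 *: star (y i) | i <- index_enum 'I_n]; split=> [_ /mapP[i _ ->]|].
  by rewrite linearZ /= hcomp_star Ey.
rewrite big_map /=.
under eq_bigr => i _ do
  rewrite starZ starK fmorphV /= (CrealP (gtr0_real N_gt0)) -scalerAl -scalerAr scalerA.
rewrite -scaler_sumr ysum scalerA -(sqrtCK (dot v' v')) -/N -invfM -expr2.
by rewrite mulVf ?scale1r // expf_neq0 // gt_eqF.
Qed.
End DegreeUnit.

Lemma star0 (C : numClosedFieldType) (A : starAlgType C) : star (0 : A) = 0.
Proof. by rewrite -[X in star X](scale0r 0) starZ rmorph0 scale0r. Qed.

(** * The Hilbert space of finite families in [V] *)

Section FfunDot.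
Variables (C : numClosedFieldType) (V : vectType C) (dot : {dot V for Num.conj}).
Variable I : finType.

Definition ffun_dot (f g : {ffun I -> V}) : C := \sum_i dot (f i) (g i).

Lemma ffun_dot_is_bilinear : bilinear_for *%R (Num.conj \; *%R) ffun_dot.
Proof.
split=> [w a f g|f a v w]; rewrite /ffun_dot /= mulr_sumr -big_split /=;
  apply: eq_bigr => i _; rewrite !ffunE.
  by rewrite linearDl linearZl_LR.
by rewrite linearDr linearZr_LR.
Qed.
HB.instance Definition _ := bilinear_isBilinear.Build C {ffun I -> V} {ffun I -> V} C
  *%R (Num.conj \; *%R) ffun_dot ffun_dot_is_bilinear.

Lemma ffun_dot_hermitian f g : ffun_dot f g = (-1) ^+ false * (ffun_dot g f)^*.
Proof.
rewrite mul1r /ffun_dot rmorph_sum; apply: eq_bigr => i _.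
by rewrite (@hermC _ _ _ _ dot) mul1r.
Qed.
HB.instance Definition _ := isHermitianSesquilinear.Build C {ffun I -> V} false
  Num.conj ffun_dot ffun_dot_hermitian.

Lemma ffun_dot_gt0 f : f != 0 -> 0 < ffun_dot f f.
Proof.
move=> f_neq0; have [i fi|f0] := pickP (fun i => f i != 0); last first.
  case/eqP: f_neq0; apply/ffunP => i; rewrite ffunE.
  by have /negbFE/eqP := f0 i.
rewrite /ffun_dot (bigD1 i) //= ltr_wpDr ?neq0_dnorm_gt0 //.
by apply: sumr_ge0 => j _; exact: dnorm_ge0.
Qed.
HB.instance Definition _ := isDotProduct.Build C {ffun I -> V} ffun_dot ffun_dot_gt0.
End FfunDot.

(** * Induction of representations along a frame *)

Section Induction.
Variables (C : numClosedFieldType) (H : hopfStarAlgType C) (P : starAlgType C).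
Variables (EP : {linear H -> P}) (I : finType) (x : I -> H).
Hypothesis EP_star : forall h, EP (star h) = star (EP h).
Hypothesis EP_frame : forall h k,
  \sum_i EP (h * x i) * EP (star (x i) * k) = EP (h * k).
Variables (V : vectType C) (dot : {dot V for Num.conj}) (rho : {linear P -> 'End(V)}).
Hypothesis rhoP : is_star_rep dot rho.

(* In the frame [x], an element [h] acts by left multiplication on the module
   induced from [V] through the matrix with entries [EP (x_i^* h x_j)]. *)
Definition ind h (f : {ffun I -> V}) : {ffun I -> V} :=
  [ffun i => \sum_j rho (EP (star (x i) * h * x j)) (f j)].

Lemma ind_is_linear h : linear (ind h).
Proof.
move=> a f g; apply/ffunP => i; rewrite !ffunE scaler_sumr -big_split /=.
by apply: eq_bigr => j _; rewrite !ffunE linearP.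
Qed.
HB.instance Definition _ h := GRing.isLinear.Build C {ffun I -> V} {ffun I -> V} *:%R
  (ind h) (ind_is_linear h).

Lemma indP a h k f : ind (a *: h + k) f = a *: ind h f + ind k f.
Proof.
apply/ffunP => i; rewrite !ffunE scaler_sumr -big_split /=.
apply: eq_bigr => j _.
by rewrite mulrDr mulrDl -scalerAr -scalerAl !linearP add_lfunE scale_lfunE.
Qed.

(** [EP_frame] says exactly that the matrices of [h] and [k] multiply to that of [h * k]. *)
Lemma indM h k f : ind h (ind k f) = ind (h * k) f.
Proof.
case: rhoP => _ rhoM _; apply/ffunP => i; rewrite !ffunE.
under eq_bigr => j _ do rewrite ffunE linear_sum /=.
rewrite exchange_big /=; apply: eq_bigr => l _.
rewrite mulrA -[in RHS](mulrA _ k) -EP_frame linear_sum sum_lfunE.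
by apply: eq_bigr => j _; rewrite rhoM comp_lfunE !mulrA.
Qed.

Lemma ind_star h f g : ffun_dot dot (ind (star h) f) g = ffun_dot dot f (ind h g).
Proof.
case: rhoP => _ _ rhoS; rewrite /ffun_dot.
under eq_bigr => i _ do rewrite ffunE linear_sumlz.
under [RHS]eq_bigr => i _ do rewrite ffunE linear_sumr.
rewrite exchange_big /=; apply: eq_bigr => j _; apply: eq_bigr => i _.
by rewrite -rhoS -EP_star !starM starK mulrA.
Qed.

(* [ind 1] is a projection; its complement carries a multiple of the counit. *)
Definition indrep h : 'End({ffun I -> V}) :=
  linfun (ind h) + counit h *: (\1 - linfun (ind 1))%VF.

Lemma indrepE h f : indrep h f = ind h f + counit h *: (f - ind 1 f).
Proof. by rewrite add_lfunE scale_lfunE add_lfunE opp_lfunE id_lfunE !lfunE. Qed.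

Lemma indrep_is_linear : linear indrep.
Proof.
move=> a h k; apply/lfunP => f; rewrite [RHS]add_lfunE.
rewrite [X in _ = X + _]scale_lfunE !indrepE indP.
by rewrite linearP /= scalerDl [a *: (_ + _)]scalerDr scalerA addrACA.
Qed.
HB.instance Definition _ := GRing.isLinear.Build C H 'End({ffun I -> V}) *:%R
  indrep indrep_is_linear.

Lemma indrep_star_rep : is_star_rep (ffun_dot dot (I:=I)) indrep.
Proof.
split=> [|h k|h f g]; [apply/lfunP => f|apply/lfunP => f|]; rewrite ?comp_lfunE !indrepE.
- by rewrite counit1 scale1r id_lfunE addrC subrK.
(* Every [ind l] kills the complement of [ind 1], because [ind l] composed with [ind 1] is
   [ind l]. *)
- have indB l c u w : ind l (u + c *: (w - ind 1 w)) = ind l u.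
    by rewrite linearD linearZ linearB /= indM mulr1 subrr scaler0 addr0.
  by rewrite !indB !indM mul1r [ind k f + _]addrC addrK counitM scalerA.
- rewrite linearDl linearZl_LR linearBl linearDr linearZr_LR linearBr /=.
  by rewrite ind_star counit_star -(star1 H) ind_star !star1.
Qed.

Lemma indrep_neq0 h i j : rho (EP (star (x i) * h * x j)) != 0 -> indrep h != 0.
Proof.
apply: contra_neq => h0; apply/lfunP => v; rewrite zero_lfunE.
pose f := [ffun l => if l == j then v else 0].
(* On the range of [ind 1] the counit term vanishes, leaving [ind h f], whose entry at [i] is the
   given operator applied to [v]. *)
have : indrep h (ind 1 f) = 0 by rewrite h0 zero_lfunE.
rewrite indrepE !indM !mulr1 subrr scaler0 addr0 => /ffunP/(_ i).
rewrite !ffunE (bigD1 j) //= ffunE eqxx big1 ?addr0 // => l /negPf lj.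
by rewrite ffunE lj linear0.
Qed.
End Induction.

Lemma RFD_frame (C : numClosedFieldType) (H : hopfStarAlgType C) (P : starAlgType C)
    (EP : {linear H -> P}) (I : finType) (x : I -> H) :
  (forall h, EP (star h) = star (EP h)) ->
  (forall h k, \sum_i EP (h * x i) * EP (star (x i) * k) = EP (h * k)) ->
  (forall h, (forall i, EP (star (x i) * h) = 0) -> h = 0) ->
  RFD P -> RFD H.
Proof.
move=> EP_star EP_frame EP_faithful RFD_P h h_neq0.
have faithful k : k != 0 -> exists i, EP (star (x i) * k) != 0.
  move=> k_neq0; apply/existsP; apply: contraT => /existsPn k0.
  by case/eqP: k_neq0; apply: EP_faithful => i; apply/eqP/negPn/k0.
have star_neq0 k : k != 0 -> star k != 0 :> H.
  by apply: contra_neq => k0; rewrite -[LHS]starK k0 star0.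
(* Faithfulness tests left multiples only. Applied to [star h] it yields a nonzero [h * x j];
   applied again to that element, it yields a nonzero matrix entry. *)
have [j hj] := faithful _ (star_neq0 _ h_neq0).
have hxj : h * x j != 0.
  apply: contraNneq hj => hxj.
  by rewrite -starM hxj star0 raddf0.
case: (faithful _ hxj) => i; rewrite mulrA => /RFD_P[V [dot [rho [rhoP rho_neq0]]]].
exists {ffun I -> V}, (ffun_dot dot (I:=I)), (indrep EP x rho); split.
  exact: indrep_star_rep.
exact: (indrep_neq0 EP_frame rhoP rho_neq0).
Qed.

(** * The conditional expectation onto the Hopf kernel *)

Section Expectation.
Variables (C : numClosedFieldType) (G : finGroupType) (H : cqgAlgType C).
Variable pi : cqgMorphism H (group_algebra C G).
Hypothesis pi_normal : normal_morphism pi.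
Local Notation E := (hcomp pi comult).

(** The grading slices the right leg, so degree one means right coinvariant, whereas [hopf_kernel]
    consists of left coinvariants; normality identifies them. *)
Lemma hcomp_lcoinvariant h : E 1%g h \in lcoinvariant pi.
Proof. by rewrite pi_normal hcomp_rcoinvariant. Qed.

Definition kerE h : hopf_kernel pi := HopfKernel (hcomp_lcoinvariant h).
Lemma kerE_is_linear : linear kerE.
Proof. by move=> a h k; apply: val_inj; rewrite /= linearP. Qed.
HB.instance Definition _ := GRing.isLinear.Build C H (hopf_kernel pi) *:%R
  kerE kerE_is_linear.

Lemma kerE_star h : kerE (star h) = star (kerE h).
Proof. by apply: val_inj; rewrite /= hcomp_star invg1. Qed.

(** A product with [h] has degree one only when the other factor has the inverse degree. *)
Lemma hcomp1_mul_deg x h k : E x h = h -> E 1%g (k * h) = E x^-1%g k * h.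
Proof.
move=> hx; rewrite hcompM (bigD1 x^-1%g) //= invgK mulg1 hx big1 ?addr0 // => y yx.
rewrite -hx hcomp_comp ?mulg1; last exact: coassoc.
by rewrite -(inj_eq invg_inj) invgK (negPf yx) mulr0.
Qed.

Lemma hcomp1_star_mul_deg x h k : E x h = h -> E 1%g (star h * k) = star h * E x k.
Proof.
move=> hx; rewrite -[star h * k]starK starM starK hcomp_star invg1.
by rewrite (hcomp1_mul_deg _ hx) starM hcomp_star invgK starK.
Qed.

Lemma RFD_of_kernel : (forall f, exists h, pi h = f) -> RFD (hopf_kernel pi) -> RFD H.
Proof.
move=> pi_surj.
have [s /all_and2[sE s1]] := choice (fun x : G => exists_degree_unit x pi_surj).
(* The frame joins the families of all degrees. *)
pose xs := [seq h | x <- enum G, h <- s x].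
have sum_xs (W : nmodType) (F : H -> W) :
    \sum_(h <- xs) F h = \sum_x \sum_(h <- s x) F h.
  by rewrite big_flatten /= big_map big_enum; apply: eq_bigr => x _; rewrite map_id.
apply: (@RFD_frame _ _ _ kerE _ (tnth (in_tuple xs)) kerE_star) => [h k|h h0].
- apply: val_inj; rewrite raddf_sum /= -(big_tnth _ _ xs xpredT
    (fun z => E 1%g (h * z) * E 1%g (star z * k))) sum_xs hcompM.
  (* For [z] of degree [x] the summand is [E x^-1 h * z * star z * E x k]. Summing over [s x]
     removes [z * star z], and summing over [x] gives the degree one part of [h * k]. *)
  rewrite [RHS](reindex_inj invg_inj) /=; apply: eq_bigr => x _.
  rewrite invgK mulg1 -[E x k]mul1r -(s1 x) mulr_suml mulr_sumr !big_seq.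
  apply: eq_bigr => z /sE zx.
  by rewrite (hcomp1_mul_deg _ zx) (hcomp1_star_mul_deg _ zx) !mulrA.
- have xs0 z : z \in xs -> E 1%g (star z * h) = 0.
    move=> /(nthP 0)[i ilt <-]; have := congr1 val (h0 (Ordinal ilt)).
    by rewrite (tnth_nth 0).
  rewrite -(@sum_hcomp _ _ _ pi _ comult h (@counitr _ _)) big1 // => x _.
  (* Each [star z * E x h] vanishes, while the elements [z * star z] with [z] in [s x] sum to [1];
     so [E x h] is zero. *)
  rewrite -[E x h]mul1r -(s1 x) mulr_suml big_seq big1 // => z zx.
  rewrite -mulrA -(hcomp1_star_mul_deg _ (sE _ _ zx)) xs0 ?mulr0 //.
  by apply/allpairsPdep; exists x, z; rewrite mem_enum.
Qed.

Lemma RFD_kernel : RFD H -> RFD (hopf_kernel pi).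
Proof.
move=> RFD_H p p_neq0.
have /RFD_H[V [dot [rho [[rho1 rhoM rhoS] rhop]]]] : hopf_kernel_val p != 0 by [].
exists V, dot, (rho \o (val : hopf_kernel pi -> H)); split=> //.
by split=> [|a b|a v w] /=; [exact: rho1|exact: rhoM|exact: rhoS].
Qed.
End Expectation.

Theorem theorem3p6 (R : realType) (H : cqgAlgType R[i]) (Gamma : finGroupType)
    (pi : cqgMorphism H (group_algebra R[i] Gamma))
    (pi_surj : forall y : group_algebra R[i] Gamma, exists x : H, pi x = y)
    (pi_normal : normal_morphism pi) :
  RFD H <-> RFD (hopf_kernel pi).
Proof. by split; [exact: RFD_kernel|exact: RFD_of_kernel]. Qed.
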